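(* Let $G\in\mathscr{U}_n$ and $x\in V_G$. Then $$n+1\le RC(x)\le \frac{n(n-1)(4n+1)}{6}-9.$$ The left equality holds if and only if $G\cong S_n^3$ and $d(x)=n-1$; the right equality holds if and only if $G\cong P_n^3$ and $x$ is a vertex such that $d(x,V_{C_3})=n-3$.
   Context: All graphs are finite, simple and undirected; $V_G,E_G$ are the vertex and edge sets of $G$, $d(x)$ is the degree of a vertex $x$, and $d(x,y)$ is the graph distance. For $X\subseteq V_G$, $d(x,X)=\min\{d(x,y): y\in X\}$ (so it is $0$ when $x\in X$). A unicyclic graph is a connected graph $G$ with $|V_G|=|E_G|$ (so it has exactly one cycle). $\mathscr{U}_n$ is the set of all unicyclic graphs on $n$ vertices. $C_n$ and $P_n$ denote the cycle and the path on $n$ vertices. $S_n^l$ is the graph obtained by attaching $n-l$ pendant (degree-one) vertices to exactly one vertex of $C_l$, and $P_n^l$ is the graph obtained by identifying one end vertex of $P_{n-l+1}$ with one vertex of $C_l$; in particular $S_n^n=P_n^n=C_n$. In $P_n^3$, $V_{C_3}$ is the vertex set of its unique cycle. The simple random walk on $G$ jumps from its current vertex $x$ to each neighbour of $x$ with probability $1/d(x)$; $H_{xy}$ is the expected value of $T_y=\inf\{k\ge 0: X_k=y\}$ for the walk $(X_k)_{k\ge0}$ started at $X_0=x$. The reverse cover cost of $x$ is $RC(x)=\sum_{y\in V_G}H_{yx}$. *)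

(* Defs.v *)
From HB Require Import structures.
From mathcomp Require Import all_boot all_order all_algebra.
From mathcomp Require Import all_classical all_reals all_analysis.

Set Implicit Arguments.
Unset Strict Implicit.
Unset Printing Implicit Defensive.

Import Order.TTheory GRing.Theory Num.Theory.

Record sgraph := SGraph {
  vertex :> finType;
  adj : rel vertex;
  adj_sym : symmetric adj;
  adj_irr : irreflexive adj }.

Definition degree (G : sgraph) (x : G) : nat := #|[set y : G | adj x y]|.

Definition edges (G : sgraph) : {set {set G}} :=
  [set [set p.1; p.2] | p : G * G & adj p.1 p.2].

Definition connected_graph (G : sgraph) : Prop :=
  forall x y : G, connect (@adj G) x y.

Definition unicyclic (n : nat) (G : sgraph) : Prop :=
  [/\ #|G| = n, connected_graph G & #|G| = #|edges G|].

Definition graph_iso (G H : sgraph) : Prop :=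
  exists2 f : G -> H,
    bijective f & forall x y : G, adj (f x) (f y) = adj x y.

(* A shortest walk has fewer than #|G| steps, so the search range suffices;
   the value is #|G| when y is not reachable from x. *)
Definition dist (G : sgraph) (x y : G) : nat :=
  find (fun k => [exists p : k.-tuple G, path (@adj G) x p && (last x p == y)])
       (iota 0 #|G|).

(* Distances never exceed #|G|, so the idle value matters only for X empty. *)
Definition dist_set (G : sgraph) (x : G) (X : {set G}) : nat :=
  \big[minn/#|G|]_(y in X) dist x y.

(* For a unicyclic graph, the vertex set of its unique cycle. *)
Definition cycle_vertices (G : sgraph) : {set G} :=
  [set v : G | `[< exists s : seq G,
                   [/\ 3 <= size s, ucycle (@adj G) s & v \in s] >]].

Section GraphOfRel.
Variables (T : finType) (r : rel T).

Definition sym_adj : rel T := fun i j => (i != j) && (r i j || r j i).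

Lemma sym_adj_sym : symmetric sym_adj.
Proof. by move=> i j; rewrite /sym_adj eq_sym orbC. Qed.

Lemma sym_adj_irr : irreflexive sym_adj.
Proof. by move=> i; rewrite /sym_adj eqxx. Qed.

Definition graph_of_rel : sgraph := SGraph sym_adj_sym sym_adj_irr.
End GraphOfRel.

(* One orientation of the edges of C_l on the vertices 0, ..., l - 1. *)
Definition cycle_arc (l i j : nat) : bool :=
  [&& i < l, j < l & j == i.+1 %% l].

(* S_n^l: the vertices l, ..., n - 1 are pendant at the cycle vertex 0. *)
Definition Sgraph (n l : nat) : sgraph :=
  graph_of_rel (fun i j : 'I_n =>
    cycle_arc l i j || (i == 0 :> nat) && (l <= j)).

(* P_n^l: the path l - 1, l, ..., n - 1 starts at the cycle vertex l - 1. *)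
Definition Pgraph (n l : nat) : sgraph :=
  graph_of_rel (fun i j : 'I_n =>
    cycle_arc l i j || (l.-1 <= i) && (j == i.+1 :> nat)).

Local Open Scope classical_set_scope.
Local Open Scope ring_scope.
Local Open Scope ereal_scope.

Definition srw_step (R : realType) (G : sgraph) (x y : G) : R :=
  if adj x y then ((degree x)%:R^-1)%R else 0%R.

(* The Markov property is the conditional probability of the next position
   given the whole past, multiplied out so that null pasts need no case. *)
Record srw_from (R : realType) (d : measure_display) (Omega : measurableType d)
    (G : sgraph) (x : G) (P : probability Omega R) (X : nat -> Omega -> G) :
    Prop := SrwFrom {
  srw_measurable : forall k (v : G), measurable [set w | X k w = v];
  srw_start : P [set w | X 0%N w = x] = 1;
  srw_markov : forall (k : nat) (s : nat -> G) (z : G),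
    P [set w | (forall i, (i <= k)%N -> X i w = s i) /\ X k.+1 w = z] =
    P [set w | forall i, (i <= k)%N -> X i w = s i] * (srw_step R (s k) z)%:E }.

(* Valued in \bar R: the infimum of the empty set is +oo. *)
Definition first_hit (R : realType) (Omega : Type) (G : sgraph)
    (X : nat -> Omega -> G) (y : G) (w : Omega) : \bar R :=
  ereal_inf [set (k%:R)%:E | k in [set k : nat | X k w = y]].

(* P x is the law under which the walk X starts at x. *)
Definition hitting_time (R : realType) (d : measure_display)
    (Omega : measurableType d) (G : sgraph) (P : G -> probability Omega R)
    (X : nat -> Omega -> G) (x y : G) : \bar R :=
  \int[P x]_w first_hit R X y w.

Definition reverse_cover_cost (R : realType) (d : measure_display)
    (Omega : measurableType d) (G : sgraph) (P : G -> probability Omega R)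
    (X : nat -> Omega -> G) (x : G) : \bar R :=
  \sum_(y : G) hitting_time P X y x.

(* Main.v *)
Require Import Defs.
From HB Require Import structures.
From mathcomp Require Import all_boot all_order all_algebra.
From mathcomp Require Import all_classical all_reals all_analysis.
From mathcomp Require Import measurable_realfun ring lra zify.

Import Order.TTheory GRing.Theory Num.Theory.
Import numFieldNormedType.Exports.
Local Open Scope ring_scope.

Set Implicit Arguments.
Unset Strict Implicit.

(** Write [h y] for the expected time to hit [x] from [y].  The tail sum formula and
    the Markov property give [h] as a series of avoidance probabilities, and
    connectedness makes the series finite ([hitting_time_potential]).  One step
    analysis then says that for [y] other than [x] the differences [h y - h z] over
    the neighbours [z] of [y] add up to the degree of [y].  Everything else follows
    from this flow equation and from edge counting.

    Lower bound.  Summed over all [y] other than [x], the flow equation gives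
    [2 n - d(x)] for the sum of [h] over the neighbours of [x].  The other
    [n - 1 - d(x)] vertices contribute at least [1] each, so the reverse cover cost is
    at least [3 n - 1 - 2 d(x)].  It is therefore at least [n + 1], with equality exactly
    when [d(x) = n - 1] ([unicyclic_lower]); in that case a single edge avoids [x], and
    the graph is S_n^3 ([unicyclic_star_iso]).

    Upper bound.  Rank the vertices by decreasing [h], so that [x] is last, and let
    [g_k] be the drop of [h] between the [k]th and the next vertex.  The reverse cover
    cost is the sum of the [k g_k].  The first [k] vertices contain [E] edges and send
    [c] edges to the rest; the flow out of them is the sum of their degrees, so
    [c g_k <= 2 E + c] ([cut_flow], [cut_gap]).  Each vertex other than [x] has a
    neighbour with smaller [h], so each has an edge to a later vertex; since there are
    [n] edges, [E + c] is [k] or [k + 1].  Hence [g_k <= 2 k + 1], and the sum of the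
    [k (2 k + 1)] for [k < n] is [n (n - 1) (4 n + 1) / 6].

    The bound [2 k + 1] is never attained for small [k], and it remains to see that at
    least [9] is lost ([excess_total]).  The losses at [k = 1, 2] are at least [2] and
    [4], and a cut with [k >= 3] that is not tight, that is with [c] different from [1]
    or [E] different from [k], loses at least [6], for a total of at least [12].  If all
    these cuts are tight, the first three vertices form a triangle left only through the
    third one, the losses at [1] and [2] are exactly [3] and [6], and single edges
    continue the triangle as a path to [x]: the graph is P_n^3 and [x] is its end
    ([tight_lollipop]).  Conversely, in P_n^3 the flow across each cut is carried by
    one edge, which determines all gaps ([lollipop_excess]). *)

(** * Hitting times of the random walk *)

(** The probability that the walk started at [u] stays away from [x] during its
    steps [1, ..., k]; the starting vertex itself is not tested. *)
Fixpoint avoid (R : realType) (G : sgraph) (x : G) (k : nat) (u : G) : R :=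
  if k is k'.+1 then \sum_(z | z != x) srw_step R u z * avoid R x k' z else 1.

Lemma probability_sum_fin (R : realType) (d : measure_display)
    (Omega : measurableType d) (P : probability Omega R) (T : finType)
    (Q : pred T) (F : T -> set Omega) :
  (forall z, measurable (F z)) -> trivIset setT F ->
  P (\bigcup_(z in [set z | Q z]) F z)%classic = (\sum_(z | Q z) P (F z))%E.
Proof.
move=> mF tF; rewrite measure_fin_bigcup //.
- have -> : [set z | Q z]%classic = [set` [seq z <- index_enum T | Q z]]%classic.
    by apply/seteqP; split => z /=; rewrite mem_filter mem_index_enum andbT.
  by rewrite -fsbig_seq ?filter_uniq ?index_enum_uniq // big_filter.
- exact: finite_finset.
- by move=> i j _ _; exact: tF.
Qed.

Lemma measurable_bounded_forall (d : measure_display) (Omega : measurableType d)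
    (D : pred nat) (Q : nat -> set Omega) : (forall i, measurable (Q i)) ->
  measurable [set w | forall i, D i -> Q i w]%classic.
Proof.
move=> mQ.
rewrite (_ : [set w | _]%classic =
  (\bigcap_(i in [set i | D i]) Q i)%classic) //.
exact: bigcap_measurableType.
Qed.

Section walk.
Variables (R : realType) (d : measure_display) (Omega : measurableType d).
Variables (G : sgraph) (P : probability Omega R) (X : nat -> Omega -> G) (y : G).
Hypothesis walk : srw_from y P X.

Let past k (s : nat -> G) := [set w | forall i, (i <= k)%N -> X i w = s i]%classic.

Lemma measurable_past k (s : nat -> G) : measurable (past k s).
Proof.
by apply: measurable_bounded_forall => i; exact: (srw_measurable walk).
Qed.

Lemma measurable_not_hit (x : G) k :
  measurable [set w | forall i, (i <= k)%N -> X i w <> x]%classic.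
Proof.
apply: measurable_bounded_forall => i; apply: measurableC.
exact: (srw_measurable walk).
Qed.

(** The Markov property for the events of avoiding [x]: conditionally on the
    trajectory up to time [j], the probability of avoiding [x] for [k] more steps
    depends only on the current position.  The induction on [k] splits the event
    according to the position at time [j + 1]. *)
Lemma prob_past_avoid (x : G) k : forall j (s : nat -> G),
  P [set w | (forall i, (i <= j)%N -> X i w = s i) /\
             (forall i, (i < k)%N -> X (j.+1 + i)%N w <> x)]%classic =
  (P [set w | forall i, (i <= j)%N -> X i w = s i]%classic
    * (avoid R x k (s j))%:E)%E.
Proof.
elim: k => [|k IH] j s.
  rewrite mule1; congr (P _); apply/seteqP; split => w /=; first by case.
  by split.
(* The past extended by one position [z] at time [j.+1]. *)
pose s' z i := if (i <= j)%N then s i else z.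
pose F z := [set w | (forall i, (i <= j.+1)%N -> X i w = s' z i) /\
             (forall i, (i < k)%N -> X (j.+2 + i)%N w <> x)]%classic.
have pastS z : [set w | forall i, (i <= j.+1)%N -> X i w = s' z i]%classic =
    [set w | (forall i, (i <= j)%N -> X i w = s i) /\ X j.+1 w = z]%classic.
  apply/seteqP; split => w /= H.
    split=> [i ij|]; first by rewrite (H _ (leqW ij)) /s' ij.
    by rewrite H // /s' ltnn.
  move=> i; rewrite leq_eqVlt => /orP[/eqP->|]; rewrite /s' ?ltnn ?H.2 //.
  by rewrite ltnS => ij; rewrite ij H.1.
rewrite (_ : [set w | _]%classic =
  \bigcup_(z in [set z | z != x]) F z)%classic; last first.
  apply/seteqP; split => w /=.
    move=> [Hp Ha]; exists (X j.+1 w) => /=.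
      by apply/eqP; have := Ha 0%N (ltn0Sn _); rewrite addn0.
    split=> [i|i ik].
      rewrite leq_eqVlt => /orP[/eqP->|]; rewrite /s' ?ltnn //.
      by rewrite ltnS => ij; rewrite ij Hp.
    by have := Ha i.+1 ik; rewrite addnS addSn.
  move=> [z /= zx [Hp Ha]].
  have : [set w | forall i, (i <= j.+1)%N -> X i w = s' z i]%classic w by [].
  rewrite pastS => -[/= Hp' Hz]; split => // -[_|i ik].
    by rewrite addn0 Hz; exact/eqP.
  by rewrite addnS -addSn; exact: Ha.
rewrite probability_sum_fin.
- transitivity (\sum_(z | z != x) P (past j s) *
     (srw_step R (s j) z * avoid R x k z)%:E)%E.
    apply: eq_bigr => z _; rewrite IH pastS (srw_markov walk) /s' ltnn.
    by rewrite EFinM muleA.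
  rewrite -ge0_sume_distrr /=; first by rewrite sumEFin.
  move=> z _; rewrite lee_fin mulr_ge0 //; first by rewrite /srw_step; case: ifP.
  elim: (k) z => //= k' IHk z; apply: sumr_ge0 => z' _; rewrite mulr_ge0 //.
  by rewrite /srw_step; case: ifP.
- move=> z; apply: measurableI; first exact: measurable_past.
  apply: measurable_bounded_forall => i; apply: measurableC.
  exact: (srw_measurable walk).
- apply/trivIsetP => z z' _ _ zz'; apply/seteqP; split => // w /= -[[Hz _] [Hz' _]].
  move: zz'; have := Hz j.+1 (leqnn _); rewrite Hz' // /s' ltnn => ->.
  by rewrite eqxx.
Qed.

Lemma srw_start_sure :
  P [set w | forall i, (i <= 0)%N -> X i w = y]%classic = 1%E.
Proof.
rewrite -(srw_start walk); congr (P _); apply/seteqP; split=> w /=; first exact.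
by move=> H i; rewrite leqn0 => /eqP ->.
Qed.

Lemma prob_not_hit (x : G) k :
  P [set w | forall i, (i <= k)%N -> X i w <> x]%classic =
  ((y != x)%:R * avoid R x k y)%:E.
Proof.
have m0 v : measurable [set w | X 0%N w = v]%classic by exact: (srw_measurable walk).
have mB := measurable_not_hit x k.
(* The walk starts at [y] almost surely. *)
have -> : P [set w | forall i, (i <= k)%N -> X i w <> x]%classic =
  P ([set w | forall i, (i <= k)%N -> X i w <> x] `&` [set w | X 0%N w = y])%classic.
  apply/eqP; rewrite eq_le; apply/andP; split; last first.
    by apply: le_measure;
      [apply/mem_set; exact: measurableI | exact/mem_set | move=> w []].
  rewrite -[leRHS]adde0.
  have <- : P (~` [set w | X 0%N w = y])%classic = 0%E.
    by rewrite probability_setC // (srw_start walk) subee.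
  have mI := measurableI _ _ mB (m0 y); have mC := measurableC (m0 y).
  apply: le_trans (measureU2 _ mI mC).
  apply: le_measure; [exact/mem_set | apply/mem_set; exact: measurableU |].
  by move=> w /= H; have [e|e] := pselect (X 0%N w = y); [left | right].
have [->|yx] /= := eqVneq y x.
  rewrite mul0r -[RHS](@measure0 _ _ _ P); congr (P _).
  by apply/seteqP; split => // w /= -[/(_ 0%N isT)].
rewrite mul1r.
have := prob_past_avoid x k 0 (fun=> y); rewrite srw_start_sure // mul1e => <-.
congr (P _); apply/seteqP; split => w /=.
  move=> [H H0]; split=> [i|i ik]; first by rewrite leqn0 => /eqP ->.
  by rewrite add1n; exact: H.
move=> [H0 H]; split; last exact: H0.
move=> -[_|i ik]; first by rewrite H0 //; exact/eqP.
by have := H i ik; rewrite add1n.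
Qed.

(** The tail sum formula for a variable valued in the extended naturals. *)
Lemma first_hitE (x : G) w : first_hit R X x w =
  (\sum_(0 <= k <oo)
    (\1_([set w | forall i, (i <= k)%N -> X i w <> x]%classic) w)%:E)%E.
Proof.
have [|nohit] := pselect (exists k, X k w == x).
  move=> /[dup] hit /ex_minnP[N /eqP XN Nmin].
  have -> : first_hit R X x w = N%:R%:E.
    apply/eqP; rewrite eq_le; apply/andP; split.
      by apply: ereal_inf_lbound; exists N.
    by apply/ereal_infP => _ [k /= /eqP Xk <-]; rewrite lee_fin ler_nat Nmin.
  rewrite (nneseries_split 0 N) // add0n.
  rewrite [X in (_ + X)%E]eseries0 ?adde0; last first.
    move=> k Nk _; rewrite indicE memNset //= => /(_ _ Nk); exact.
  rewrite big_nat (eq_bigr (fun=> 1%E)); last first.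
    move=> k /andP[_ kN]; rewrite indicE mem_set //= => i ik /eqP /Nmin.
    by rewrite leqNgt (leq_ltn_trans ik kN).
  by rewrite -big_nat sumEFin sumr_const_nat subn0.
have -> : first_hit R X x w = +oo%E.
  rewrite /first_hit (_ : [set _ | _ in _]%classic = set0)%classic ?ereal_inf0 //.
  by apply/seteqP; split => // _ [k /= Xk _]; apply: nohit; exists k; apply/eqP.
apply/esym/eqyP => A A0.
pose M := (Num.bound A).
apply: le_trans (nneseries_lim_ge M _) => //.
rewrite (eq_bigr (fun=> 1%E)); last first.
  move=> k _; rewrite indicE mem_set //= => i ik Xi.
  by apply: nohit; exists i; apply/eqP.
by rewrite sumEFin sumr_const_nat subn0 lee_fin ltW // archi_boundP // ltW.
Qed.

(** Summing the tails makes the hitting time a series even when it is infinite;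
    finiteness is a separate matter. *)
Lemma hitting_series (x : G) : (\int[P]_w first_hit R X x w =
  \sum_(0 <= k <oo) ((y != x)%:R * avoid R x k y)%:E)%E.
Proof.
have mB := measurable_not_hit x.
under eq_integral do rewrite first_hitE.
rewrite integral_nneseries //.
- apply: eq_eseriesr => k _; rewrite integral_indic // setIT.
  exact: prob_not_hit.
- by move=> k; apply/measurable_EFinP; exact: measurable_indic.
Qed.

End walk.

(** * Flows and potentials on a graph *)

(** Viewing [f] as a potential, the flow along an edge cancels the flow along the
    reversed edge. *)
Lemma sum_flow0 (R : zmodType) (G : sgraph) (f : G -> R) :
  \sum_y \sum_(z | adj y z) (f y - f z) = 0.
Proof.
transitivity (\sum_y \sum_(z | adj y z) f y - \sum_y \sum_(z | adj y z) f z).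
  by rewrite -sumrB; apply: eq_bigr => y _; rewrite sumrB.
rewrite [X in _ - X](exchange_big_dep xpredT) //=.
apply/eqP; rewrite subr_eq0; apply/eqP; apply: eq_bigr => y _.
by apply: eq_bigl => z; rewrite adj_sym.
Qed.

Lemma sum_flow_return (R : zmodType) (G : sgraph) (f : G -> R) (x : G) :
  \sum_(y | y != x) \sum_(z | adj y z) (f y - f z) =
  \sum_(z | adj x z) (f z - f x).
Proof.
have := sum_flow0 f; rewrite (bigD1 x) //= => /eqP.
rewrite addrC addr_eq0 => /eqP ->; rewrite -sumrN.
by apply: eq_bigr => z _; rewrite opprB.
Qed.

Lemma degree_gt0 (G : sgraph) (u z : G) : adj u z -> (0 < degree u)%N.
Proof. by move=> uz; apply/card_gt0P; exists z; rewrite inE. Qed.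

Lemma sum_adj_const (R : pzSemiRingType) (G : sgraph) (u : G) (c : R) :
  \sum_(z | adj u z) c = (degree u)%:R * c.
Proof. by rewrite sumr_const mulr_natl /degree cardsE. Qed.

(** * Finiteness of the expected hitting times *)

Section truncated.
Variables (R : realType) (G : sgraph) (x : G).
Hypothesis connG : connected_graph G.

(** The expectation of the minimum of [N] and the time at which the walk started
    at [u] hits [x]. *)
Definition truncated_time N (u : G) : R :=
  \sum_(0 <= k < N) ((u != x)%:R * avoid R x k u).

Local Notation S := truncated_time.

Lemma avoid_ge0 k u : 0 <= avoid R x k u.
Proof.
elim: k u => //= k IHk u; apply: sumr_ge0 => z _; rewrite mulr_ge0 //.
by rewrite /srw_step; case: ifP.
Qed.

Lemma truncated_time_ge0 N u : 0 <= S N u.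
Proof. by apply: sumr_ge0 => k _; rewrite mulr_ge0 ?avoid_ge0. Qed.

Lemma truncated_time_nd u : nondecreasing_seq (S ^~ u).
Proof.
apply/nondecreasing_seqP => N; rewrite /S big_nat_recr //= lerDl.
by rewrite mulr_ge0 ?avoid_ge0.
Qed.

Lemma truncated_time0 N : S N x = 0.
Proof. by rewrite /S big1 // => k _; rewrite eqxx mul0r. Qed.

Lemma other_degree_gt0 u : u != x -> (0 < degree u)%N.
Proof.
move=> ux; case/connectP: (connG u x) => -[/=|z p] /=.
  by move=> _ xu; rewrite xu eqxx in ux.
by case/andP => /degree_gt0.
Qed.

(** One step analysis, multiplied by the degree. *)
Lemma truncated_timeS N u : u != x ->
  \sum_(z | adj u z) (S N.+1 u - S N z) = (degree u)%:R.
Proof.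
move=> ux; have du : (degree u)%:R != 0 :> R.
  by rewrite pnatr_eq0 -lt0n other_degree_gt0.
have -> : S N.+1 u = 1 + (degree u)%:R^-1 * \sum_(z | adj u z) S N z.
  rewrite /S big_nat_recl //= ux !mul1r; congr (_ + _).
  under eq_bigr do rewrite mul1r.
  rewrite exchange_big /= mulr_sumr big_mkcond [RHS]big_mkcond.
  apply: eq_bigr => z _; rewrite /srw_step mulr_sumr.
  case: (z != x); case: (adj u z) => //=.
  - by apply: eq_bigr => k _; rewrite mul1r.
  - by rewrite big1 // => k _; rewrite mul0r.
  - by rewrite big1 // => k _; rewrite mul0r mulr0.
by rewrite sumrB sum_adj_const mulrDr mulr1 mulrA mulfV // mul1r addrK.
Qed.

(** Boundedness spreads along edges.  Around [x] it comes from summing the one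
    step identities over all vertices other than [x]; a bound at any other vertex
    bounds its neighbours by one step analysis. *)
Lemma truncated_time_bounded u : exists C, forall N, S N u <= C.
Proof.
have base : exists C, forall z, adj x z -> forall N, S N z <= C.
  exists (\sum_(y | y != x) (degree y)%:R) => z xz N.
  have le1 : S N z <= \sum_(z | adj x z) (S N z - S N x).
    rewrite (bigD1 z) //= truncated_time0 subr0 lerDl.
    by apply: sumr_ge0 => z' _; rewrite subr0 truncated_time_ge0.
  apply: le_trans le1 _; rewrite -sum_flow_return.
  case: N => [|N].
    rewrite big1 ?sumr_ge0 // => y _; rewrite big1 // => z' _.
    by rewrite /S !big_geq // subrr.
  apply: ler_sum => y yx; rewrite -(truncated_timeS N yx).
  apply: ler_sum => z' _; rewrite lerB // truncated_time_nd //.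
have step v z : adj v z -> (exists C, forall N, S N v <= C) ->
    exists C, forall N, S N z <= C.
  move=> vz [C HC]; have [vx|vx] := eqVneq v x.
    by case: base => C' HC'; exists C' => N; apply: HC'; rewrite -vx.
  exists ((degree v)%:R * C) => N.
  apply: (@le_trans _ _ ((degree v)%:R * S N.+1 v)); last by rewrite ler_wpM2l.
  apply: (@le_trans _ _ (\sum_(z | adj v z) S N z)).
    by rewrite (bigD1 z) //= lerDl sumr_ge0 // => z' _; exact: truncated_time_ge0.
  by rewrite -subr_ge0 -sum_adj_const -sumrB truncated_timeS.
case/connectP: (connG x u) => p; elim/last_ind: p u => [|p z IH] u /=.
  by move=> _ ->; exists 0 => N; rewrite truncated_time0.
rewrite rcons_path last_rcons => /andP[xp pz] ->.
exact: step pz (IH _ xp erefl).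
Qed.

End truncated.

(** The expected hitting times of [x] are finite, and they solve the equations of
    one step analysis. *)
Lemma hitting_time_potential (R : realType) (d : measure_display)
    (Omega : measurableType d) (G : sgraph) (P : G -> probability Omega R)
    (X : nat -> Omega -> G) (x : G) (connG : connected_graph G)
    (hX : forall y : G, srw_from y (P y) X) :
  exists h : G -> R, [/\ h x = 0, forall y, 0 <= h y,
    forall y, y != x -> \sum_(z | adj y z) (h y - h z) = (degree y)%:R
    & forall y, hitting_time P X y x = (h y)%:E].
Proof.
pose S := truncated_time R x.
pose h y := limn (S ^~ y).
have cvS y : (S ^~ y @ \oo --> h y)%classic.
  apply: nondecreasing_is_cvgn; first exact: truncated_time_nd.
  have [C HC] := @truncated_time_bounded R G x connG y.
  by exists C => _ [N _ <-].
exists h; split.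
- apply/cvg_lim => //; rewrite (_ : S ^~ x = fun=> 0); first exact: cvg_cst.
  by apply/funext => N; exact: truncated_time0.
- move=> y; apply: limr_ge; first exact: cvS.
  by apply: nearW => N; exact: truncated_time_ge0.
- move=> y yx; have lim1 : (\sum_(z | adj y z) (S N.+1 y - S N z) @[N --> \oo]
      --> \sum_(z | adj y z) (h y - h z))%classic.
    apply: cvg_big => [|z _]; first exact: add_continuous.
    apply: cvgB; last exact: cvS.
    by rewrite (@cvg_shiftS _ (S ^~ y)); exact: cvS.
  apply: (cvg_unique _ lim1) => //.
  rewrite (_ : (fun N => _) = fun=> (degree y)%:R); first exact: cvg_cst.
  by apply/funext => N; exact: truncated_timeS.
- move=> y; rewrite /hitting_time (hitting_series (hX y)).
  apply/cvg_lim => //.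
  under eq_fun do rewrite sumEFin.
  by apply: cvg_EFin; [exact: nearW | exact: cvS].
Qed.

(** * Edge counts *)

(** A ranking of the vertices orients every edge, hence counts it once. *)
Lemma card_edges_ordered (G : sgraph) (pos : G -> nat) : injective pos ->
  #|edges G| = (\sum_(u : G) \sum_(v : G) (adj u v && (pos u < pos v)))%N.
Proof.
move=> pos_inj; pose D := [set p : G * G | adj p.1 p.2 && (pos p.1 < pos p.2)%N].
have -> : edges G = [set [set p.1; p.2] | p in D]%SET.
  apply/setP => A; apply/imsetP/imsetP => -[[u v]]; rewrite !inE /=.
    move=> uv ->; have [lt|lt|/pos_inj e] := ltngtP (pos u) (pos v).
    - by exists (u, v); rewrite ?inE /= ?uv ?lt.
    - exists (v, u); first by rewrite inE /= adj_sym uv.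
      by rewrite finset.setUC.
    - by move: uv; rewrite e adj_irr.
  by case/andP => uv _ ->; exists (u, v); rewrite ?inE.
rewrite card_in_imset; last first.
  move=> [u v] [u' v']; rewrite !inE /= => /andP[_ lt] /andP[_ lt'] /setP e.
  have := e u; have := e v; rewrite !inE !eqxx ?orbT /=.
  move=> /esym/orP[]/eqP ev /esym/orP[]/eqP eu; rewrite ?ev ?eu //.
  - by move: lt; rewrite ev eu ltnn.
  - by move: lt lt'; rewrite ev eu; lia.
  - by move: lt; rewrite ev eu ltnn.
rewrite -sum1_card big_mkcond pair_big /=.
by apply: eq_bigr => p _; rewrite inE; case: ifP.
Qed.

Lemma sum_degree (G : sgraph) : (\sum_(u : G) degree u = 2 * #|edges G|)%N.
Proof.
have pos_inj : injective (fun u : G => enum_rank u : nat).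
  by move=> u v /val_inj /enum_rank_inj.
rewrite (card_edges_ordered pos_inj) mul2n -addnn {2}exchange_big -big_split /=.
apply: eq_bigr => u _; rewrite -big_split /= /degree -sum1_card big_mkcond /=.
apply: eq_bigr => v _; rewrite inE (adj_sym v u).
case: (boolP (adj u v)) => //= uv; case: ltngtP => // /pos_inj e.
by move: uv; rewrite e adj_irr.
Qed.

(** * Graphs isomorphic to a graph on ordinals *)

(** An enumeration of the vertices under which adjacency becomes the symmetric
    closure of [r] is an isomorphism. *)
Lemma iso_of_enum (G : sgraph) n (r : rel 'I_n) (s : seq G) (x0 : G) :
  uniq s -> size s = n -> (forall v, v \in s) ->
  (forall i j : 'I_n, (i < j)%N ->
     adj (nth x0 s i) (nth x0 s j) = r i j || r j i) ->
  graph_iso G (graph_of_rel r).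
Proof.
move=> us ss ms sr.
have idx v : (index v s < n)%N by rewrite -ss index_mem.
exists (fun v => Ordinal (idx v) : graph_of_rel r) => [|u v] /=.
  exists (fun i : 'I_n => nth x0 s i) => [v|i]; first by rewrite /= nth_index.
  by apply: val_inj; rewrite /= index_uniq // ss.
rewrite /sym_adj -val_eqE /= -[in RHS](nth_index x0 (ms u)).
rewrite -[in RHS](nth_index x0 (ms v)).
have [lt|lt|e] := ltngtP (index u s) (index v s).
- by rewrite (sr (Ordinal (idx u)) (Ordinal (idx v))).
- by rewrite orbC adj_sym (sr (Ordinal (idx v)) (Ordinal (idx u))).
- by rewrite [in RHS]e adj_irr.
Qed.

(** * The lower bound *)

(** The potential [h] behaves like the expected hitting times of [x]: away from [x]
    the equation says that [h y] is one more than the mean of [h] over the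
    neighbours of [y]. *)
Definition hitting_potential (R : realType) (G : sgraph) (x : G) (h : G -> R) :=
  [/\ h x = 0, forall y, 0 <= h y &
    forall y, y != x -> \sum_(z | adj y z) (h y - h z) = (degree y)%:R].

Section potential.
Variables (R : realType) (G : sgraph) (x : G) (h : G -> R).
Hypothesis connG : connected_graph G.
Hypothesis pot : hitting_potential x h.

Lemma potential_descent y : y != x -> exists2 z, adj y z & h z < h y.
Proof.
case: pot => _ _ hf yx; apply: contrapT => H.
have := hf y yx; apply/eqP; rewrite lt_eqF //.
apply: (@le_lt_trans _ _ 0); last by rewrite ltr0n (other_degree_gt0 connG yx).
apply: sumr_le0 => z yz; rewrite subr_le0 leNgt; apply/negP => lt.
by apply: H; exists z.
Qed.

Lemma potential_ge1 y : y != x -> 1 <= h y.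
Proof.
case: pot => _ h0 hf yx.
have dy : 0 < (degree y)%:R :> R by rewrite ltr0n (other_degree_gt0 connG yx).
rewrite -(ler_pM2l dy) mulr1 -[leLHS](hf y yx) -sum_adj_const.
by apply: ler_sum => z _; rewrite gerBl.
Qed.

(** This is the formula for the expected return time to [x], multiplied by the
    degree of [x]. *)
Lemma sum_neighbours_potential :
  \sum_(z | adj x z) h z = 2 * #|edges G|%:R - (degree x)%:R.
Proof.
case: pot => hx0 _ hf.
transitivity (\sum_(z | adj x z) (h z - h x)).
  by apply: eq_bigr => z _; rewrite hx0 subr0.
rewrite -sum_flow_return (eq_bigr (fun y => (degree y)%:R) hf).
rewrite -natrM -sum_degree natr_sum.
by rewrite [in RHS](bigD1 x) //= addrAC subrr add0r.
Qed.

Lemma card_non_neighbours :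
  #|[pred y | (y != x) && ~~ adj x y]| = (#|G| - 1 - degree x)%N.
Proof.
suff : #|G| = (degree x + (1 + #|[pred y | (y != x) && ~~ adj x y]|))%N by lia.
rewrite /degree cardsE -!sum1_card (bigID (adj x)) /=; congr (_ + _)%N.
rewrite (bigD1 x) ?adj_irr //=; congr (_ + _)%N.
by apply: eq_bigl => y; rewrite inE andbC.
Qed.

(** The neighbours of [x] contribute a known amount, and each of the other vertices
    contributes at least [1]. *)
Lemma sum_potential_ge :
  2 * #|edges G|%:R - (degree x)%:R + (#|G| - 1 - degree x)%:R <= \sum_y h y.
Proof.
case: pot => hx0 h0 _.
rewrite (bigID (adj x)) /= sum_neighbours_potential lerD2l.
rewrite -card_non_neighbours -sum1_card natr_sum.
rewrite [leRHS](bigD1 x) ?adj_irr //= hx0 add0r.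
rewrite [leLHS](eq_bigl (fun y => ~~ adj x y && (y != x))); last first.
  by move=> y; rewrite inE andbC.
by apply: ler_sum => y /andP[_ yx]; exact: potential_ge1.
Qed.

Lemma sum_potential_eq : degree x = (#|G| - 1)%N ->
  \sum_y h y = 2 * #|edges G|%:R - (degree x)%:R.
Proof.
case: pot => hx0 _ _ dx.
rewrite (bigID (adj x)) /= sum_neighbours_potential big1 ?addr0 // => y xy.
have [->//|yx] := eqVneq y x.
have := card_non_neighbours; rewrite dx subnn => /card0_eq/(_ y).
by rewrite !inE yx xy.
Qed.

End potential.

Lemma degree_lt (G : sgraph) (x : G) : (degree x < #|G|)%N.
Proof.
rewrite /degree -cardsT; apply: proper_card; apply/properP.
by split; [exact: finset.subsetT | exists x; rewrite ?inE ?adj_irr].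
Qed.

(** With [n] edges the bound above reads [3 n - 1 - 2 d(x)], which is smallest when
    [d(x)] is largest. *)
Lemma unicyclic_lower (R : realType) (G : sgraph) (x : G) (h : G -> R) n :
  unicyclic n G -> hitting_potential x h ->
  n%:R + 1 <= \sum_y h y /\ (\sum_y h y = n%:R + 1 <-> degree x = (n - 1)%N).
Proof.
case=> Gn connG; rewrite Gn => /esym Ge pot.
have := degree_lt x; have := sum_potential_ge connG pot; rewrite Gn Ge => H dn.
have [dx|dx] := eqVneq (degree x) (n - 1)%N.
  have -> : \sum_y h y = n%:R + 1.
    rewrite (sum_potential_eq pot) ?Gn ?Ge //.
    by rewrite dx natrB ?(leq_trans _ dn) //; lra.
  by [].
suff lt : n%:R + 1 < \sum_y h y.
  split; first exact: ltW.
  by split => e; [move: lt; rewrite e ltxx | rewrite e eqxx in dx].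
apply: lt_le_trans H.
have -> : (n - 1 - degree x = (n - 2 - degree x).+1)%N by lia.
have -> : n%:R = (degree x)%:R + (n - 2 - degree x)%:R + 2 :> R.
  by rewrite -!natrD; congr (_%:R); lia.
have := ler0n R (n - 2 - degree x); rewrite -natr1; lra.
Qed.

(** When [x] is adjacent to all other vertices, its edges account for all but one of
    the [n] edges. *)
Lemma unicyclic_star_iso (G : sgraph) (x : G) n :
  unicyclic n G -> degree x = (n - 1)%N -> graph_iso G (Sgraph n 3).
Proof.
case=> Gn connG; rewrite Gn => /esym Ge dx.
(* Ranking [x] first makes the edges at [x] the ones oriented out of [x]. *)
pose pos (u : G) : nat := if u == x then 0%N else (enum_rank u).+1.
have pos_inj : injective pos.
  move=> u v; rewrite /pos; case: eqVneq => [->|_]; case: eqVneq => [->|_] //.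
  by move=> /succn_inj/val_inj/enum_rank_inj.
have xadj y : y != x -> adj x y.
  move=> yx; apply: contrapT => /negP xy.
  have := card_non_neighbours x; rewrite Gn dx subnn => /card0_eq/(_ y).
  by rewrite !inE yx xy.
have := card_edges_ordered pos_inj; rewrite Ge (bigD1 x) //=.
rewrite (_ : (\sum_v _)%N = degree x); last first.
  rewrite /degree -sum1_card [RHS]big_mkcond /=; apply: eq_bigr => v _; rewrite inE.
  case: (boolP (adj x v)) => //=; rewrite /pos eqxx; case: eqVneq => // ->.
  by rewrite adj_irr.
(* The edges that avoid [x], each oriented once. *)
pose D := [set p : G * G | [&& p.1 != x, adj p.1 p.2 & (pos p.1 < pos p.2)%N]].
rewrite (_ : (\sum_(i | _) _)%N = #|D|); last first.
  rewrite -sum1_card [RHS]big_mkcond pair_big /= [LHS]big_mkcond /=.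
  by apply: eq_bigr => p _; rewrite inE andbT; case: (p.1 != x) => //=; case: ifP.
have n0 : (0 < n)%N by rewrite -Gn; apply/card_gt0P; exists x.
rewrite dx => eD.
have /eqP/cards1P[[a b] De] : #|D| = 1%N by lia.
have : (a, b) \in D by rewrite De inE.
rewrite inE /= => /and3P[ax ab pab].
have bx : b != x by apply: contraTneq pab => ->; rewrite {2}/pos eqxx.
have nab : a != b by apply: contraTneq ab => ->; rewrite adj_irr.
have others u v : u != x -> v \notin [:: x; a; b] -> ~~ adj u v.
  rewrite !inE !negb_or => ux /and3P[vx va vb]; apply/negP => uv.
  have : ((u, v) \in D) || ((v, u) \in D).
    rewrite !inE /= ux vx (adj_sym v) uv /=; case: ltngtP => // /pos_inj e.
    by move: uv; rewrite e adj_irr.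
  by rewrite De !inE !xpair_eqE (negbTE va) (negbTE vb) /= !andbF.
pose s := [:: x; a; b] ++ [seq v <- enum G | v \notin [:: x; a; b]].
have us : uniq s.
  rewrite cat_uniq filter_uniq ?enum_uniq //= !inE !negb_or.
  rewrite eq_sym ax eq_sym bx nab /= andbT -all_predC; apply/allP => v.
  by rewrite mem_filter => /andP[].
have ms v : v \in s.
  by rewrite mem_cat mem_filter mem_enum; case: (v \in [:: x; a; b]).
have ss : size s = n.
  by rewrite -Gn -(card_uniqP us); apply: eq_card => v; rewrite ms.
apply: (iso_of_enum (s := s) (x0 := x)) => // i j ij.
have jx : nth x s j != x.
  have -> : (nth x s j != x) = (nth x s j != nth x s 0%N) by [].
  by rewrite nth_uniq ?ss //; case: (nat_of_ord j) ij.
case ei : (nat_of_ord i) => [|i'].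
  rewrite /= xadj //; case: (nat_of_ord j) ij => [|[|[|j']]] //; by rewrite ei.
case ej : (nat_of_ord j) ij => [|[|[|j']]]; rewrite ei // => ij.
  have -> : i' = 0%N by lia.
  by rewrite /= ab.
rewrite /cycle_arc /= !andbF !orbF /=; apply/negbTE/others.
- have -> : (nth x s i'.+1 != x) = (nth x s i'.+1 != nth x s 0%N) by [].
  by rewrite nth_uniq ?ss // -ei.
- have: nth x s j'.+3 \in [seq v <- enum G | v \notin [:: x; a; b]].
    rewrite /s /=; apply: mem_nth.
    have := ltn_ord j; rewrite ej -ss /s size_cat /=; lia.
  by rewrite mem_filter => /andP[].
Qed.

(** * Cuts of a ranked graph *)

(** The relation [e] on the ranks below [n] is a triangle on [0, 1, 2] continued by
    the path [2, 3, ..., n - 1]. *)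
Definition lollipop_order (n : nat) (e : rel nat) :=
  forall i j, (i < j < n)%N -> e i j = (j <= 2)%N || (j == i.+1).

Section cuts.
Variables (n : nat) (e : rel nat).

(** The number of edges between ranks below [k]. *)
Definition inner k := (\sum_(0 <= j < k) \sum_(0 <= i < j) e i j)%N.

(** The number of edges between ranks below [k] and ranks at least [k]. *)
Definition cut k := (\sum_(0 <= i < k) \sum_(k <= j < n) e i j)%N.

(** The number of edges from [i] to larger ranks. *)
Definition forward i := (\sum_(i.+1 <= j < n) e i j)%N.

Lemma innerS k : inner k.+1 = (inner k + \sum_(0 <= i < k) e i k)%N.
Proof. by rewrite /inner big_nat_recr. Qed.

Lemma inner_cut k : (k <= n)%N ->
  (inner k + cut k = \sum_(0 <= i < k) forward i)%N.
Proof.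
elim: k => [|k IH] kn; first by rewrite /inner /cut !big_geq.
rewrite big_nat_recr //= -IH ?(ltnW kn) // innerS /cut big_nat_recr //=.
under [X in _ = (_ + X + _)%N]eq_bigr do rewrite big_ltn //.
rewrite big_split /= -/(forward k); lia.
Qed.

Hypotheses (e_sym : symmetric e) (e_irr : irreflexive e).

Lemma double_inner k : (\sum_(0 <= i < k) \sum_(0 <= j < k) e i j = 2 * inner k)%N.
Proof.
elim: k => [|k IH]; first by rewrite /inner !big_geq.
rewrite big_nat_recr //=.
under eq_bigr do rewrite big_nat_recr //=.
rewrite big_split /= IH innerS big_nat_recr //= e_irr.
have -> : (\sum_(0 <= i < k) e k i = \sum_(0 <= i < k) e i k)%N.
  by apply: eq_bigr => i _; rewrite e_sym.
lia.
Qed.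

(** In the lollipop only the edge from [k - 1] to [k] crosses the cut at [k]. *)
Lemma lollipop_cut_sum (V : nmodType) (f : nat -> nat -> V) k :
  lollipop_order n e -> (3 <= k < n)%N ->
  \sum_(0 <= i < k) \sum_(k <= j < n | e i j) f i j = f k.-1 k.
Proof.
move=> lol /andP[k3 kn].
case: k k3 kn => // k k3 kn.
rewrite big_nat_recr //= big1_seq ?add0r => [|i]; last first.
  rewrite mem_index_iota => /andP[_ /andP[_ ik]].
  rewrite big_nat_cond big1 // => j /andP[/andP[kj jn]].
  by rewrite lol; [move=> H; exfalso; lia | lia].
rewrite big_mkcond big_ltn //= lol; last by lia.
rewrite eqxx orbT big_nat_cond big1 ?addr0 // => j /andP[/andP[kj jn] _].
rewrite lol; last by lia.
by rewrite ifF //; lia.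
Qed.

Lemma lollipop_cut k : lollipop_order n e -> (3 <= k < n)%N -> cut k = 1%N.
Proof.
move=> lol kn; rewrite -(lollipop_cut_sum (fun _ _ => 1%N) lol kn) /cut.
apply: eq_bigr => i _; rewrite [RHS]big_mkcond.
by apply: eq_bigr => j _; case: (e i j).
Qed.

Lemma lollipop_inner k : lollipop_order n e -> (3 <= k < n)%N -> inner k = k.
Proof.
move=> lol; elim: k => // k IH /andP[k3 kn].
rewrite innerS; have [k2|k2] := eqVneq k 2%N.
  rewrite {}k2 in kn *.
  by rewrite /inner unlock /= !lol //; lia.
rewrite IH; last by lia.
case: k k3 kn k2 {IH} => // k k3 kn k2.
rewrite big_nat_recr //= lol; last by lia.
rewrite eqxx orbT big_nat_cond big1 ?addn1 // => i /andP[/andP[_ ik] _].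
rewrite lol; last by lia.
by apply/eqP; rewrite eqb0; lia.
Qed.

End cuts.

Section ranked.
Variables (R : realFieldType) (n : nat) (e : rel nat) (a : nat -> R).
Hypotheses (e_sym : symmetric e) (e_irr : irreflexive e).
Hypothesis a_flow : forall i, (i.+1 < n)%N ->
  \sum_(0 <= j < n | e i j) (a i - a j) = (\sum_(0 <= j < n) e i j)%N%:R.

Local Notation inner := (inner e).
Local Notation cut := (cut n e).
Local Notation forward := (forward n e).

(** The flow out of the ranks below [k] equals the sum of their degrees. *)
Lemma cut_flow k : (k < n)%N ->
  \sum_(0 <= i < k) \sum_(k <= j < n | e i j) (a i - a j) =
  (2 * inner k + cut k)%:R.
Proof.
move=> kn.
have part (F : nat -> nat -> R) :
    \sum_(0 <= i < k) \sum_(0 <= j < n | e i j) F i j =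
    \sum_(0 <= i < k) \sum_(0 <= j < k | e i j) F i j +
    \sum_(0 <= i < k) \sum_(k <= j < n | e i j) F i j.
  rewrite -big_split /=; apply: eq_bigr => i _.
  by rewrite (@big_cat_nat _ _ _ k) //= ltnW.
have tot : \sum_(0 <= i < k) \sum_(0 <= j < n | e i j) (a i - a j) =
    (2 * inner k + cut k)%:R.
  transitivity ((\sum_(0 <= i < k) \sum_(0 <= j < n) e i j)%N%:R : R).
    rewrite natr_sum; apply: eq_big_nat => i /andP[_ ik].
    by apply: a_flow; exact: leq_trans kn.
  rewrite -(double_inner e_sym e_irr) /cut -big_split /=; congr (_%:R).
  by apply: eq_bigr => i _; rewrite -big_cat_nat //= ltnW.
rewrite -tot part -[LHS]add0r; congr (_ + _).
under eq_bigr do rewrite sumrB.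
rewrite sumrB; apply/esym/eqP; rewrite subr_eq0; apply/eqP.
rewrite [RHS](exchange_big_dep_nat xpredT) //=; apply: eq_bigr => i _.
by apply: eq_bigl => j; rewrite e_sym.
Qed.

(** The amount by which the gap below rank [k] falls short of [2 k + 1], weighted by
    the number [k] of values above that gap. *)
Definition excess k : R := k%:R * ((2 * k + 1)%:R - (a k.-1 - a k)).

(** The two equations of one step analysis at ranks [0] and [1]. *)
Lemma triangle_gaps : (2 < n)%N -> e 0%N 1%N -> e 0%N 2%N -> e 1%N 2%N ->
  (forall j, (2 < j < n)%N -> ~~ e 0%N j && ~~ e 1%N j) ->
  a 0%N = a 2%N + 2 /\ a 1%N = a 2%N + 2.
Proof.
move=> n2 e01 e02 e12 far.
have F1 : \sum_(0 <= j < n | e 0%N j) (a 0%N - a j) = 2.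
  rewrite a_flow ?(ltn_trans _ n2) //.
  rewrite (@big_cat_nat _ _ _ 3) //= [X in (_ + X)%N]big_nat_cond.
  rewrite [X in (_ + X)%N]big1 => [|j /andP[/far/andP[/negbTE-> _] _]] //.
  by rewrite unlock /= e_irr e01 e02.
have F2 : \sum_(0 <= j < n | e 1%N j) (a 1%N - a j) = 2.
  rewrite a_flow //.
  rewrite (@big_cat_nat _ _ _ 3) //= [X in (_ + X)%N]big_nat_cond.
  rewrite [X in (_ + X)%N]big1 => [|j /andP[/far/andP[_ /negbTE->] _]] //.
  by rewrite unlock /= e_irr e12 e_sym e01.
move: F1 F2.
rewrite (@big_cat_nat _ _ _ 3) //= [X in (_ + X)]big_nat_cond.
rewrite [X in (_ + X)]big1 => [|j /andP[/far/andP[/negbTE-> _]]] //.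
rewrite (@big_cat_nat _ _ _ 3 0 n) //= [X in _ -> (_ + X) = _ -> _]big_nat_cond.
rewrite [X in _ -> (_ + X) = _ -> _]big1 => [|j /andP[/far/andP[_ /negbTE->]]] //.
rewrite unlock /= !e_irr e01 e02 e12 (e_sym 1%N 0%N) e01 /=; lra.
Qed.

Lemma lollipop_excess : (2 < n)%N -> lollipop_order n e ->
  \sum_(1 <= k < n) excess k = 9.
Proof.
move=> n2 lol.
have [] := triangle_gaps n2; rewrite ?lol //; try lia.
  by move=> j jn; rewrite !lol; lia.
move=> a0 a1.
rewrite (@big_cat_nat _ _ _ 3) //=.
have -> : \sum_(3 <= k < n) excess k = 0.
  rewrite big_nat_cond big1 // => k /andP[kn _].
  have := cut_flow (proj2 (andP kn)).
  rewrite (lollipop_cut_sum (fun i j => a i - a j) lol kn).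
  rewrite (lollipop_cut lol kn) (lollipop_inner lol kn) /excess => ->.
  by rewrite subrr mulr0.
by rewrite unlock /= /excess /= a0 a1; lra.
Qed.

Hypothesis a_antitone : forall i j, (i <= j < n)%N -> a j <= a i.

(** Each edge across the cut carries at least the gap at [k]. *)
Lemma cut_gap k : (0 < k < n)%N ->
  (cut k)%:R * (a k.-1 - a k) <= (2 * inner k + cut k)%:R.
Proof.
move=> /andP[k0 kn]; rewrite -cut_flow // /cut natr_sum mulr_suml.
rewrite [leLHS]big_nat_cond [leRHS]big_nat_cond.
apply: ler_sum => i /andP[/andP[_ ik] _]; rewrite natr_sum mulr_suml.
rewrite [leLHS]big_nat_cond [leRHS]big_mkcond [leRHS]big_nat_cond.
apply: ler_sum => j /andP[/andP[kj jn] _].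
case: (e i j); rewrite ?mul0r // mul1r lerB // a_antitone ?kj ?jn //.
by rewrite -ltnS prednK // ik; lia.
Qed.

(** A single edge crosses the cut at [k], and there are [k] edges below it.  With
    only one cycle around, the ranks below [k] then contain it. *)
Definition tight k := (cut k == 1%N) && (inner k == k).

Lemma excess_tight k : (0 < k < n)%N -> tight k -> 0 <= excess k.
Proof.
move=> kn /andP[/eqP c1 /eqP ik]; have := cut_gap kn.
by rewrite /excess c1 ik mul1r => H; rewrite mulr_ge0 // subr_ge0.
Qed.

(** Summation by parts writes the sum of the [a i] as the sum of [k] times the [k]th
    gap; gaps of [2 k + 1] would give the closed form on the right. *)
Lemma sum_excess : (0 < n)%N -> a n.-1 = 0 ->
  \sum_(0 <= i < n) a i =
  n%:R * (n%:R - 1) * (4 * n%:R + 1) / 6 - \sum_(1 <= k < n) excess k.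
Proof.
case: n => // m _ /= am.
suff H : \sum_(0 <= i < m.+1) a i = m.+1%:R * (m.+1%:R - 1) * (4 * m.+1%:R + 1) / 6
   - \sum_(1 <= k < m.+1) excess k + m.+1%:R * a m.
  by rewrite H am mulr0 addr0.
elim: m {am} => [|m IH].
  by rewrite big_nat1 [X in _ - X]big_geq // subrr; ring.
rewrite big_nat_recr //= IH [in RHS]big_nat_recr //= /excess /=.
rewrite natrD natrM -!natr1; by field.
Qed.

Hypothesis n_gt0 : (0 < n)%N.
Hypothesis e_count : (\sum_(0 <= i < n) forward i = n)%N.
Hypothesis e_forward : forall i, (i.+1 < n)%N -> (0 < forward i)%N.

Lemma n_ge3 : (2 < n)%N.
Proof.
move: e_count n_gt0; rewrite /forward; case: n => [|[|[|m]]] // + _.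
  by rewrite unlock.
by rewrite unlock /=; case: (e 0%N 1%N).
Qed.

(** The [n] edges exceed by one the [n - 1] forward edges guaranteed at the ranks
    below [n - 1], so exactly one rank has two forward edges. *)
Lemma forward_sum_bounds k : (k < n)%N ->
  (k <= \sum_(0 <= i < k) forward i <= k.+1)%N.
Proof.
move=> kn; have ge (p q : nat) : (q < n)%N ->
    (q - p <= \sum_(p <= i < q) forward i)%N.
  move=> qn; rewrite -{1}[(q - p)%N]muln1 -sum_nat_const_nat.
  rewrite [leqLHS]big_nat_cond [leqRHS]big_nat_cond.
  apply: leq_sum => i /andP[/andP[_ iq] _].
  by apply: e_forward; exact: leq_trans qn.
have := ge 0%N _ kn; rewrite subn0 => -> /=.
have := ge k n.-1 ltac:(lia); have := e_count.
rewrite (@big_cat_nat _ _ _ k) ?(ltnW kn) //=.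
rewrite (@big_cat_nat _ _ _ n.-1 k) ?leq_pred //=; lia.
Qed.

Lemma cut_gt0 k : (0 < k < n)%N -> (0 < cut k)%N.
Proof.
case: k => // k /= kn; rewrite /cut big_nat_recr //= addn_gt0.
by apply/orP; right; exact: e_forward.
Qed.

(** If several edges cross the cut, the gap is at most [k]; if one edge does and the
    cycle is not among the ranks below [k], the gap is at most [2 k - 1]. *)
Lemma excess_slack k : (3 <= k < n)%N -> ~~ tight k -> 6 <= excess k.
Proof.
move=> /andP[k3 kn] nt.
have kn' : (0 < k < n)%N by lia.
have k3R : 3 <= k%:R :> R by rewrite ler_nat.
have c0 := cut_gt0 kn'; have := cut_gap kn'.
have := forward_sum_bounds kn; rewrite -inner_cut ?(ltnW kn) // => /andP[lo hi].
rewrite /excess; set g := a k.-1 - a k.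
move: nt; rewrite /tight; have [c1|c1] /= := eqVneq (cut k) 1%N => nt.
  have ik : (inner k).+1 = k by lia.
  rewrite c1 mul1r -{3}ik => gle.
  have : g <= 2 * k%:R - 1.
    by apply: le_trans gle _; rewrite natrD natrM -{2}ik -natr1; lra.
  rewrite natrD natrM; nra.
move=> gle; have gk : g <= k%:R.
  rewrite leNgt; apply/negP => kg.
  have c2 : 2 <= (cut k)%:R :> R by rewrite ler_nat; lia.
  have : (2 * inner k + cut k)%:R <= 2 * k%:R + 2 - (cut k)%:R :> R.
    rewrite lerBrDr -!natrM -!natrD ler_nat; lia.
  nra.
rewrite natrD natrM; nra.
Qed.

Lemma excess1 : 2 <= excess 1.
Proof.
have n3 := n_ge3; have k1 : (0 < 1 < n)%N by lia.
have := cut_gap k1; have := cut_gt0 k1; rewrite -(ltr0n R).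
rewrite /excess /inner /= natrD natrM unlock /= mulr0 add0r; nra.
Qed.

Lemma excess2 : 4 <= excess 2.
Proof.
have n3 := n_ge3; have k2 : (0 < 2 < n)%N by lia.
have := cut_gap k2; have := cut_gt0 k2; rewrite -(ler1n R).
have : (inner 2)%:R <= 1 :> R.
  by rewrite lern1 /inner unlock /=; case: (e 0%N 1%N).
rewrite /excess /= !natrD !natrM; nra.
Qed.

(** When [n] is [3] the hypothesis is void, and the three edges form the triangle. *)
Lemma tight3_triangle : ((3 < n)%N -> tight 3) ->
  [/\ e 0%N 1%N, e 0%N 2%N, e 1%N 2%N &
   forall j, (2 < j < n)%N -> ~~ e 0%N j && ~~ e 1%N j].
Proof.
move=> t3; have n3 := n_ge3.
have i3 : inner 3 = 3%N.
  move: n3; rewrite leq_eqVlt => /orP[/eqP n3|/t3/andP[_ /eqP//]].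
  have c0 : cut n = 0%N by rewrite /cut big1 // => i _; rewrite big_geq.
  by have := inner_cut e (leqnn n); rewrite e_count c0 addn0 -n3.
move: i3; rewrite /inner unlock /= !addn0.
case: (e 0%N 1%N) (e 0%N 2%N) (e 1%N 2%N) => -[] [] // _; split => // j /andP[j3 jn].
have /t3/andP[/eqP + _] : (3 < n)%N by exact: leq_trans jn.
have := e_forward (i := 2) ltac:(lia).
rewrite /cut (@big_ltn _ _ _ 0 3) // (@big_ltn _ _ _ 1 3) //.
rewrite (@big_ltn _ _ _ 2 3) // (@big_geq _ _ _ 3 3) // -/(forward 2).
have pos (F : nat -> bool) : F j -> (0 < \sum_(3 <= i < n) F i)%N.
  by move=> Fj; rewrite (bigD1_seq j) ?iota_uniq ?mem_index_iota ?j3 //= Fj.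
case: (boolP (e 0%N j)) => [/pos|_]; first by lia.
by case: (boolP (e 1%N j)) => [/pos|_]; first by lia.
Qed.

(** If all cuts from [3] on are tight, ranks [0] and [1] close a triangle above rank
    [2] and already lose exactly [3 + 6]; otherwise the loss is at least
    [2 + 4 + 6]. *)
Lemma excess_total :
  9 <= \sum_(1 <= k < n) excess k /\
  (\sum_(1 <= k < n) excess k = 9 -> forall k, (3 <= k < n)%N -> tight k).
Proof.
have n3 := n_ge3.
pose S := \sum_(3 <= k < n) excess k.
have -> : \sum_(1 <= k < n) excess k = excess 1 + excess 2 + S.
  rewrite (@big_cat_nat _ _ _ 3) //=; congr (_ + _).
  by rewrite (@big_ltn _ _ _ 1 3) // big_nat1.
have [all_tight|] := pselect (forall k, (3 <= k < n)%N -> tight k).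
  split=> //.
  have [e01 e02 e12 far] : [/\ e 0%N 1%N, e 0%N 2%N, e 1%N 2%N &
      forall j, (2 < j < n)%N -> ~~ e 0%N j && ~~ e 1%N j].
    by apply: tight3_triangle => n4; apply: all_tight; rewrite n4.
  have [a0 a1] := triangle_gaps n3 e01 e02 e12 far.
  have S0 : 0 <= S.
    rewrite /S big_nat_cond sumr_ge0 // => k /andP[kn _].
    by apply: excess_tight; [lia | exact: all_tight].
  by rewrite /excess /= a0 a1; lra.
move=> /existsNP[k /not_implyP[kn /negP nt]].
have S6 : 6 <= S.
  rewrite /S (bigD1_seq k) ?iota_uniq ?mem_index_iota //=.
  rewrite -[leLHS]addr0 lerD ?(excess_slack kn nt) //.
  rewrite big_seq_cond sumr_ge0 // => i /andP[]; rewrite mem_index_iota => iN _.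
  have [ti|/(excess_slack iN) H] := boolP (tight i); last by lra.
  by apply: excess_tight => //; lia.
have x1 := excess1; have x2 := excess2; split; first lra.
by move=> total; exfalso; lra.
Qed.

(** Tight cuts admit a single edge each, which must issue from the last rank below
    the cut. *)
Lemma tight_lollipop : (forall k, (3 <= k < n)%N -> tight k) ->
  lollipop_order n e.
Proof.
move=> all_tight; have n3 := n_ge3.
have [e01 e02 e12 _] : [/\ e 0%N 1%N, e 0%N 2%N, e 1%N 2%N &
      forall j, (2 < j < n)%N -> ~~ e 0%N j && ~~ e 1%N j].
  by apply: tight3_triangle => n4; apply: all_tight; rewrite n4.
have nocross i k j : (i.+1 < k)%N -> (3 <= k <= j)%N -> (j < n)%N -> ~~ e i j.
  move=> ik kj jn; have kn : (3 <= k < n)%N by lia.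
  have /andP[/eqP c1 _] := all_tight _ kn.
  apply/negP => eij.
  case: k ik kj kn c1 => // k ik kj kn; rewrite /cut big_nat_recr //=.
  have : (0 < forward k)%N by apply: e_forward; lia.
  rewrite (bigD1_seq i) ?iota_uniq ?mem_index_iota //=.
  rewrite (bigD1_seq j) ?iota_uniq ?mem_index_iota //=; last by lia.
  rewrite eij /forward; lia.
move=> i j /andP[ij jn]; case: (leqP j 2) => [j2|j3] /=.
  by case: i j ij j2 {jn} => [|[|i]] [|[|[|j]]].
have [ji|ji] := eqVneq j i.+1; last first.
  by apply/negbTE/(nocross i j j); lia.
rewrite {}ji in ij jn j3 *; have := e_forward jn.
rewrite /forward big_ltn; last by lia.
rewrite big_nat_cond big1 ?addn0 => [|l /andP[/andP[il ln] _]].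
  by case: (e i i.+1).
by apply/eqP; rewrite eqb0; apply: (nocross i l l); lia.
Qed.

End ranked.

(** * Graphs enumerated by a sequence *)

(** The sequence [s] lists each element of [T] exactly once; the rank of an element
    is its index in [s], counted from [0]. *)
Definition enumerates (T : finType) (s : seq T) := uniq s /\ forall v, v \in s.

Lemma size_enumerates (T : finType) (s : seq T) : enumerates s -> size s = #|T|.
Proof. by case=> us ms; rewrite -(card_uniqP us); apply: eq_card => v; rewrite ms. Qed.

Lemma big_enumerates (V : nmodType) (T : finType) (s : seq T) (x0 : T)
    (Q : pred T) (F : T -> V) : enumerates s ->
  \sum_(v | Q v) F v = \sum_(0 <= i < #|T| | Q (nth x0 s i)) F (nth x0 s i).
Proof.
move=> en; rewrite -(size_enumerates en) -(big_nth x0); apply: perm_big.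
case: en => us ms; apply: uniq_perm => //; first exact: index_enum_uniq.
by move=> v; rewrite mem_index_enum ms.
Qed.

(** Adjacency between the vertices of rank [i] and [j] in [s]; the default value [x] is
    used for ranks out of range. *)
Definition rank_adj (G : sgraph) (x : G) (s : seq G) : rel nat :=
  fun i j => adj (nth x s i) (nth x s j).

Section ranked_graph.
Variables (G : sgraph) (x : G) (s : seq G).
Hypothesis en : enumerates s.

Local Notation e := (rank_adj x s).
Local Notation n := #|G|.

Lemma rank_adj_sym : symmetric e.
Proof. by move=> i j; rewrite /rank_adj adj_sym. Qed.

Lemma rank_adj_irr : irreflexive e.
Proof. by move=> i; rewrite /rank_adj adj_irr. Qed.

Lemma index_inj : injective (index^~ s).
Proof.
by move=> u v /= uv; rewrite -(nth_index x (en.2 u)) uv nth_index // en.2.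
Qed.

Lemma index_lt u : (index u s < n)%N.
Proof. by rewrite -(size_enumerates en) index_mem en.2. Qed.

Lemma index_nth i : (i < n)%N -> index (nth x s i) s = i.
Proof. by move=> lt; rewrite index_uniq ?en.1 // (size_enumerates en). Qed.

Lemma adj_rank u v : adj u v = e (index u s) (index v s).
Proof. by rewrite /rank_adj !nth_index ?en.2. Qed.

Lemma sum_forward : (\sum_(0 <= i < n) forward n e i = #|edges G|)%N.
Proof.
rewrite (card_edges_ordered index_inj) (big_enumerates x _ _ en).
apply: eq_big_nat => i /andP[_ ilt].
rewrite (big_enumerates x _ _ en) (@big_cat_nat _ _ _ i.+1) //=.
rewrite big_nat_cond big1 ?add0n => [|j /andP[/andP[_ ji] _]]; last first.
  rewrite !index_nth //; last by lia.
  by rewrite [(i < j)%N]ltnNge -ltnS ji andbF.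
apply: eq_big_nat => j /andP[ij jn]; rewrite !index_nth //.
by rewrite ij andbT.
Qed.

Lemma degree_rank i : degree (nth x s i) = (\sum_(0 <= j < n) e i j)%N.
Proof.
rewrite /degree cardsE -sum1_card (big_enumerates x _ _ en) big_mkcond /=.
by apply: eq_bigr => j _; rewrite /rank_adj /in_mem /=; case: (adj _ _).
Qed.

Section lollipop.
Hypothesis lol : lollipop_order n e.

(** The triangle counts as a single level, whence the maximum with [2]. *)
Lemma lollipop_lipschitz u v : adj u v ->
  (maxn 2 (index u s) <= (maxn 2 (index v s)).+1)%N.
Proof.
rewrite adj_rank; have := index_lt u; have := index_lt v.
have [uv|vu|->] := ltngtP (index u s) (index v s) => vn un; try lia.
by rewrite rank_adj_sym lol; lia.
Qed.

Lemma lollipop_path_size u p : path (@adj G) u p ->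
  (maxn 2 (index u s) <= maxn 2 (index (last u p) s) + size p)%N.
Proof.
elim: p u => [|v p IH] u /=; first by rewrite addn0.
by move=> /andP[/lollipop_lipschitz uv /IH vp]; lia.
Qed.

Lemma lollipop_descending_path i : (2 <= i < n)%N ->
  exists p, [/\ path (@adj G) (nth x s i) p, last (nth x s i) p = nth x s 2
    & size p = (i - 2)%N].
Proof.
elim: i => // i IH /andP[i2 lt]; have [e2|i2'] := eqVneq i 1%N.
  by exists [::]; rewrite e2.
have [p [pp pl ps]] := IH ltac:(lia).
exists (nth x s i :: p); split=> //=; last by rewrite ps; lia.
by rewrite pp -/(e i.+1 i) rank_adj_sym lol ?eqxx ?orbT //; lia.
Qed.

Hypothesis n3 : (2 < n)%N.

(** In a cycle the vertex of largest rank has two neighbours of smaller rank, which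
    the lollipop allows only inside the triangle. *)
Lemma lollipop_cycle_vertices v : (v \in cycle_vertices G) = (index v s <= 2)%N.
Proof.
rewrite inE; apply/asboolP/idP => [[c [c3 /andP[cc uc] vc]]|v2]; last first.
  pose c := [:: nth x s 0; nth x s 1; nth x s 2].
  exists c; split => //.
    have tri i j : (i < j <= 2)%N -> adj (nth x s i) (nth x s j).
      by move=> ij; rewrite -/(e i j) lol; lia.
    rewrite /ucycle /cycle /= (adj_sym (nth x s 2)) !tri //=.
    by rewrite !inE !nth_uniq ?(size_enumerates en) ?en.1 //; lia.
  rewrite -(nth_index x (en.2 v)) !inE.
  by case: (index v s) v2 => [|[|[|]]] // _; rewrite eqxx ?orbT.
rewrite leqNgt; apply/negP => v2.
case: (@arg_maxnP _ v (mem c) (index^~ s) vc) => u uc' umax.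
have u2 : (2 < index u s)%N by apply: leq_trans v2 _; exact: umax.
have lower w : w \in c -> adj u w -> index w s = (index u s).-1.
  move=> /umax /= wu uw.
  have lt : (index w s < index u s)%N.
    rewrite ltn_neqAle wu andbT; apply: contraTneq uw => /index_inj ->.
    by rewrite adj_irr.
  move: uw; rewrite adj_rank rank_adj_sym lol; have := index_lt u; lia.
(* Rotated to start at [u], the cycle has the two neighbours of [u] as second
   and last vertices. *)
case: (rot_to uc') => k c' rc.
move: cc uc c3; rewrite -(rot_cycle k) -(rot_uniq k) -(size_rot k).
have inc w : w \in rot k c -> w \in c by rewrite mem_rot.
rewrite {}rc in inc *.
case: c' inc => [|a c'] //; case/lastP: c' => [|c' b] // inc /=.
rewrite rcons_path last_rcons => /andP[ua /andP[_ bu]].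
move=> /and3P[_ + _] _; rewrite mem_rcons inE negb_or => /andP[ab _].
have ia := lower a (inc a _) ua.
have ib := lower b (inc b _).
have : a = b.
  apply: index_inj; rewrite /= ia ?ib ?(adj_sym u) //.
    by rewrite !inE mem_rcons !inE eqxx !orbT.
  by rewrite !inE eqxx orbT.
by move=> abE; rewrite abE eqxx in ab.
Qed.

End lollipop.
End ranked_graph.

(** * Distances *)

Lemma dist_le (G : sgraph) (u : G) (p : seq G) :
  path (@adj G) u p -> (size p < #|G|)%N -> (dist u (last u p) <= size p)%N.
Proof.
move=> pp lt; rewrite leqNgt; apply/negP => /(before_find 0%N).
rewrite nth_iota // add0n => /existsP[].
by exists (in_tuple p); rewrite /= pp eqxx.
Qed.

Lemma dist_ge (G : sgraph) (u v : G) k : (k <= #|G|)%N ->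
  (forall p, path (@adj G) u p -> last u p = v -> (k <= size p)%N) ->
  (k <= dist u v)%N.
Proof.
move=> kG H; rewrite /dist; set Q := (fun k : nat => _).
have [hQ|nQ] := boolP (has Q (iota 0 #|G|)); last by rewrite hasNfind // size_iota.
have := nth_find 0%N hQ; rewrite has_find size_iota in hQ.
rewrite nth_iota // add0n => /existsP[p /andP[pp /eqP pl]].
by have := H p pp pl; rewrite size_tuple.
Qed.

Lemma dist_set_le (G : sgraph) (u v : G) (A : {set G}) : v \in A ->
  (dist_set u A <= dist u v)%N.
Proof.
rewrite /dist_set => vA; have : v \in index_enum G by rewrite mem_index_enum.
elim: (index_enum G) => // w r IH; rewrite inE big_cons => /orP[/eqP <-|/IH le].
  by rewrite vA geq_minl.
by case: ifP => // _; rewrite geq_min le orbT.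
Qed.

Lemma dist_set_ge (G : sgraph) (u : G) (A : {set G}) k : (k <= #|G|)%N ->
  (forall v, v \in A -> (k <= dist u v)%N) -> (k <= dist_set u A)%N.
Proof.
move=> kG H; rewrite /dist_set; elim/big_ind: _ => // m1 m2 k1 k2.
by rewrite leq_min k1.
Qed.

Lemma lollipop_dist_set (G : sgraph) (x : G) (s : seq G) : (2 < #|G|)%N ->
  enumerates s -> lollipop_order #|G| (rank_adj x s) ->
  (dist_set x (cycle_vertices G) = index x s - 2)%N.
Proof.
move=> n3 en lol; have cyc := lollipop_cycle_vertices en lol n3.
have xn := index_lt en x.
apply/eqP; rewrite eqn_leq; apply/andP; split; last first.
  apply: dist_set_ge; first by lia.
  move=> v; rewrite cyc => v2; apply: dist_ge => [|p pp pl]; first by lia.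
  by have := lollipop_path_size en lol pp; rewrite pl; lia.
have [x2|x2] := leqP (index x s) 2.
  have xc : x \in cycle_vertices G by rewrite cyc.
  have := dist_set_le x xc.
  have : (dist x (last x [::]) <= 0)%N.
    by apply: (@dist_le _ x [::]) => //; exact: ltn_trans n3.
  by rewrite /=; lia.
have xr : (2 <= index x s < #|G|)%N by lia.
have [p [pp pl ps]] := lollipop_descending_path lol xr.
rewrite nth_index ?en.2 // in pp pl.
rewrite -ps; apply: leq_trans (dist_le pp _); last first.
  by rewrite ps (leq_ltn_trans (leq_subr _ _) xn).
by apply: dist_set_le; rewrite pl cyc index_nth //.
Qed.

(** * The lollipop graph *)

Lemma Pgraph_rel n (i j : 'I_n) : (i < j)%N ->
  adj (i : Pgraph n 3) j = (j <= 2)%N || (j == i.+1 :> nat).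
Proof.
case: i j => [i ilt] [j jlt] /= ij.
rewrite /sym_adj /cycle_arc -val_eqE /=.
case: (leqP j 2) => j2.
  by case: i j ij j2 {ilt jlt} => [|[|i]] [|[|[|j]]].
rewrite ?andbF /=; lia.
Qed.

Lemma lollipop_iso (G : sgraph) (x : G) (s : seq G) :
  enumerates s -> lollipop_order #|G| (rank_adj x s) ->
  graph_iso G (Pgraph #|G| 3).
Proof.
move=> en lol; apply: (iso_of_enum (s := s) (x0 := x)).
- exact: en.1.
- exact: size_enumerates.
- exact: en.2.
move=> i j ij; have := Pgraph_rel ij; rewrite /= /sym_adj.
rewrite -val_eqE /= (ltn_eqF ij) /= => ->.
by rewrite -/(rank_adj x s i j) lol // ij /=.
Qed.

Lemma iso_lollipop (G : sgraph) (x : G) : graph_iso G (Pgraph #|G| 3) ->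
  exists2 s : seq G, enumerates s & lollipop_order #|G| (rank_adj x s).
Proof.
case=> f [g fK gK] fadj.
have en : enumerates [seq g i | i <- enum 'I_#|G|].
  split; first by rewrite map_inj_uniq ?enum_uniq //; exact: can_inj gK.
  by move=> v; rewrite -(fK v); apply: map_f; rewrite mem_enum.
exists [seq g i | i <- enum 'I_#|G|] => // i j /andP[ij jn].
have il : (i < #|G|)%N by lia.
have nthE k (kn : (k < #|G|)%N) :
    nth x [seq g i | i <- enum 'I_#|G|] k = g (Ordinal kn).
  rewrite (nth_map (Ordinal kn)) ?size_enum_ord //; congr g.
  by apply: val_inj; rewrite /= nth_enum_ord.
rewrite /rank_adj (nthE _ il) (nthE _ jn) -fadj !gK.
exact: (@Pgraph_rel _ (Ordinal il) (Ordinal jn)).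
Qed.

(** * The upper bound *)

Section upper.
Variables (R : realType) (G : sgraph) (x : G) (h : G -> R).
Hypothesis pot : hitting_potential x h.

Local Notation n := #|G|.
Local Notation upper := (n%:R * (n%:R - 1) * (4 * n%:R + 1) / 6 - 9 : R).

Lemma potential_rank_flow (s : seq G) : enumerates s -> nth x s n.-1 = x ->
  forall i, (i.+1 < n)%N ->
  \sum_(0 <= j < n | rank_adj x s i j) (h (nth x s i) - h (nth x s j)) =
  (\sum_(0 <= j < n) rank_adj x s i j)%N%:R.
Proof.
move=> en xl i iN; rewrite -degree_rank //.
case: pot => _ _ hf; rewrite -hf; first by rewrite (big_enumerates x _ _ en).
rewrite -[X in _ != X]xl nth_uniq ?(size_enumerates en) ?en.1; lia.
Qed.

Lemma card_gt0_vertex : (0 < n)%N.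
Proof. by apply/card_gt0P; exists x. Qed.

(** The sum is determined by the shape of the graph when [x] ends its path. *)
Lemma lollipop_sum_potential (s : seq G) : (2 < n)%N -> enumerates s ->
  nth x s n.-1 = x -> lollipop_order n (rank_adj x s) -> \sum_y h y = upper.
Proof.
move=> n3 en xl lol; have [hx0 _ _] := pot.
have hl : h (nth x s n.-1) = 0 by rewrite xl.
have fl := potential_rank_flow en xl.
rewrite (big_enumerates x _ _ en).
rewrite (sum_excess (a := fun i => h (nth x s i)) card_gt0_vertex hl).
by rewrite (lollipop_excess (rank_adj_sym x s) (rank_adj_irr x s) fl n3 lol).
Qed.

(** The vertices by decreasing potential; [x] comes last. *)
Definition by_potential : seq G := sort (fun u v => h v <= h u) (enum G).

Lemma enumerates_by_potential : enumerates by_potential.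
Proof. by split => [|v]; rewrite ?sort_uniq ?mem_sort ?enum_uniq ?mem_enum. Qed.

Lemma by_potential_antitone i j : (i <= j < n)%N ->
  h (nth x by_potential j) <= h (nth x by_potential i).
Proof.
move=> /andP[ij jn].
have srt : sorted (fun u v => h v <= h u) by_potential.
  by apply: sort_sorted => u v; exact: le_total.
have tr : transitive (fun u v : G => h v <= h u).
  by move=> u v w /= vu uw; exact: le_trans uw vu.
by apply: (sorted_leq_nth tr _ x srt) => //;
  rewrite inE (size_enumerates enumerates_by_potential) //; lia.
Qed.

Hypothesis connG : connected_graph G.

Lemma by_potential_last : nth x by_potential n.-1 = x.
Proof.
have en := enumerates_by_potential; have n0 := card_gt0_vertex.
apply: contrapT => /eqP lx.
have := by_potential_antitone (i := index x by_potential) (j := n.-1).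
rewrite nth_index ?en.2 // => /(_ ltac:(have := index_lt en x; lia)).
have [-> _ _] := pot; apply/negP; rewrite -ltNge.
by apply: lt_le_trans (potential_ge1 connG pot lx).
Qed.

Lemma unicyclic_upper : n = #|edges G| ->
  [/\ (2 < n)%N, \sum_y h y <= upper &
  \sum_y h y = upper -> exists s, [/\ enumerates s, nth x s n.-1 = x &
    lollipop_order n (rank_adj x s)]].
Proof.
move=> uniG; have en := enumerates_by_potential; have xl := by_potential_last.
have n0 := card_gt0_vertex; have [hx0 _ _] := pot.
set s := by_potential in en xl.
have es := rank_adj_sym x s; have ei := rank_adj_irr x s.
have hl : h (nth x s n.-1) = 0 by rewrite xl.
have fl := potential_rank_flow en xl.
have ec : (\sum_(0 <= i < n) forward n (rank_adj x s) i = n)%N.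
  by rewrite sum_forward.
have fw i : (i.+1 < n)%N -> (0 < forward n (rank_adj x s) i)%N.
  move=> iN; have ix : nth x s i != x.
    rewrite -[X in _ != X]xl nth_uniq ?(size_enumerates en) ?en.1; lia.
  have [z iz lt] := potential_descent connG pot ix.
  have zN := index_lt en z.
  have zE : nth x s (index z s) = z by rewrite nth_index ?en.2.
  have iz' : (i < index z s)%N.
    rewrite ltnNge; apply/negP => zi.
    have := by_potential_antitone (i := index z s) (j := i).
    by rewrite -/s zE zi ltnW // => /(_ isT); rewrite leNgt lt.
  rewrite /forward (bigD1_seq (index z s)) ?iota_uniq ?mem_index_iota ?iz' //=.
  by rewrite /rank_adj zE iz.
have anti := by_potential_antitone; rewrite -/s in anti.
have [ge9 eq9] := excess_total (a := fun i => h (nth x s i)) es ei fl anti n0 ec fw.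
have tot := sum_excess (a := fun i => h (nth x s i)) n0 hl.
rewrite (big_enumerates x _ _ en) tot; split.
- exact: (n_ge3 n0 ec).
- by rewrite lerD2l lerN2.
move=> eqU; exists s; split=> //.
apply: (tight_lollipop n0 ec fw); apply: eq9.
by move: eqU => /addrI/oppr_inj.
Qed.

End upper.

(** * The theorem *)

Theorem theorem1p5 (R : realType) (d : measure_display)
    (Omega : measurableType d) (n : nat) (G : sgraph)
    (P : G -> probability Omega R) (X : nat -> Omega -> G) (x : G)
    (hG : unicyclic n G) (hX : forall y : G, srw_from y (P y) X) :
  let RC : \bar R := reverse_cover_cost P X x in
  let lower : R := n%:R + 1 in
  let upper : R := n%:R * (n%:R - 1) * (4 * n%:R + 1) / 6 - 9 in
  [/\ (lower%:E <= RC)%E,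
      (RC <= upper%:E)%E,
      RC = lower%:E <-> graph_iso G (Sgraph n 3) /\ degree x = (n - 1)%N
    & RC = upper%:E <->
      graph_iso G (Pgraph n 3) /\ dist_set x (cycle_vertices G) = (n - 3)%N].
Proof.
have [Gn connG Ge] := hG.
have [h [hx0 h0 hf hit]] := hitting_time_potential x connG hX.
have pot : hitting_potential x h by split.
move=> RC lower upper.
have RCE : RC = (\sum_y h y)%:E.
  by rewrite /RC /reverse_cover_cost -sumEFin; apply: eq_bigr => y _.
have [le_lo eq_lo] := unicyclic_lower hG pot.
have [n3 le_up eq_up] := unicyclic_upper pot connG Ge.
have EFin_eq (a b : R) : (a%:E = b%:E) = (a = b).
  by apply/propext; split=> [[]|->].
rewrite RCE !lee_fin !EFin_eq; split => //.
- by rewrite /upper -Gn.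
- split=> [/eq_lo dx|[_ /eq_lo]//]; split=> //.
  exact: unicyclic_star_iso hG dx.
rewrite /upper -Gn; split.
  move=> /eq_up[s [en xl lol]]; split; first exact: lollipop_iso en lol.
  rewrite (lollipop_dist_set n3 en lol) -{1}xl index_nth //; lia.
move=> [/(iso_lollipop x)[s en lol]].
rewrite (lollipop_dist_set n3 en lol) => xs.
(* For the triangle the two bounds coincide, and any rank of [x] is possible. *)
have [n4|n4] := eqVneq #|G| 3%N.
  apply/eqP; rewrite eq_le le_up /=; apply: le_trans le_lo.
  by rewrite -Gn n4; lra.
apply: (lollipop_sum_potential pot n3 en _ lol).
have -> : #|G|.-1 = index x s by have := index_lt en x; lia.
by rewrite nth_index ?en.2.
Qed.
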